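(* Let $\tau$ be a permutation, and let $\lambda_1,\lambda_2,\ldots$ be random permutations on a common probability space such that, for each $\ell\ge 1$, $\lambda_\ell$ is uniformly distributed on $S_\ell$. Then for every permutation (pattern) $\pi$, almost surely the limit density $t(\pi,\tau[\bullet]) := \lim_{\ell\to\infty} t(\pi,\tau[\lambda_\ell])$ exists and equals $$t(\pi, \tau[\bullet]) = \frac{|\pi|!}{|\tau|^{|\pi|}} \sum_{(\sigma, b) \in B(\pi)} \left(\binom{|\tau|}{|\sigma|}\, t(\sigma, \tau) \cdot \prod_{i=1}^{|\sigma|} \frac{1}{(|b_i|!)^2}\right).$$
   Context: A permutation of length $n\ge 1$ is a bijection of $[n]=\{1,\dots,n\}$, written as the tuple of its values; $S_n$ is the set of these and $|\tau|$ denotes the length of $\tau$. A tuple $(a_1,\dots,a_k)$ of distinct integers is order-isomorphic to $\pi\in S_k$ if $a_i<a_j \iff \pi(i)<\pi(j)$ for all $i,j$. Density: for $\pi\in S_k$ and a permutation $\tau$ with $|\tau|\ge k$, $t(\pi,\tau)$ is the probability that the restriction of $\tau$ to a uniformly random $k$-element subset of its indices (listed in increasing order of index) is order-isomorphic to $\pi$. When $|\tau|<k$, the product $\binom{|\tau|}{k}t(\pi,\tau)$ is interpreted as $0$ (e.g. by setting $t(\pi,\tau)=0$). Inflation: for $\tau\in S_n$ and permutations $\gamma_1,\dots,\gamma_n$ (each of length at least $1$), $\tau[\gamma_1,\dots,\gamma_n]$ is the permutation of length $|\gamma_1|+\cdots+|\gamma_n|$ consisting of $n$ consecutive blocks of indices,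 the $i$-th of length $|\gamma_i|$, such that the $i$-th block is order-isomorphic to $\gamma_i$ and every restriction to one element from each block is order-isomorphic to $\tau$. Tensor product: $\tau[\gamma]=\tau[\gamma,\dots,\gamma]$; that is, for $\tau\in S_n$, $\gamma\in S_m$, $\tau[\gamma]((i-1)m+j)=(\tau(i)-1)m+\gamma(j)$ for $i\in[n]$, $j\in[m]$. The random inflation $\tau[\bullet]$ is the sequence of random permutations $\tau[\lambda_1],\tau[\lambda_2],\ldots$. Block decomposition: a block decomposition of $\pi$ of order $\ell$ is a pair $(\sigma,b)$ with $\sigma\in S_\ell$ and $b=(b_1,\dots,b_\ell)$ a sequence of permutations such that $\pi=\sigma[b_1,\dots,b_\ell]$. $B(\pi)$ denotes the set of all block decompositions of $\pi$ (of all orders). *)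

(* Defs.v *)
From HB Require Import structures.
From mathcomp Require Import all_boot all_order all_fingroup all_algebra.
From mathcomp Require Import all_classical all_reals all_analysis.
Set Implicit Arguments.
Unset Strict Implicit.
Unset Printing Implicit Defensive.
Import Order.TTheory GRing.Theory Num.Theory.
Import numFieldNormedType.Exports.
Local Open Scope classical_set_scope.
Local Open Scope nat_scope.

(* Permutations of length n are elements of 'S_n: indices and values run over
   0, ..., n-1 instead of 1, ..., n. *)

Definition word n (p : 'S_n) : seq nat := [seq val (p i) | i <- enum 'I_n].

Definition order_iso (s : seq nat) k (p : 'S_k) : bool :=
  (size s == k) &&
  [forall i : 'I_k, forall j : 'I_k,
     (nth 0 s i < nth 0 s j) == (p i < p j)].

(* [enum A] lists the index set A in increasing order. *)
Definition restriction n (t : 'S_n) (A : {set 'I_n}) : seq nat :=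
  [seq val (t i) | i <- enum A].

(* For n < k there is no k-subset, the denominator is 0, and the value is 0. *)
Definition density (R : realType) k n (p : 'S_k) (t : 'S_n) : R :=
  (#|[set A : {set 'I_n} | (#|A| == k) && order_iso (restriction t A) p]|%:R
   / 'C(n, k)%:R)%R.

Section Tensor.
Variables (n m : nat).
Implicit Types (t : 'S_n) (g : 'S_m) (x : 'I_(n * m)).

Lemma tensor_width_gt0 x : 0 < m.
Proof. by case: m x => // -[y]; rewrite muln0. Qed.

Lemma tensor_block_subproof x : x %/ m < n.
Proof. by rewrite ltn_divLR // (tensor_width_gt0 x). Qed.

Lemma tensor_pos_subproof x : x %% m < m.
Proof. by rewrite ltn_mod (tensor_width_gt0 x). Qed.

Definition tensor_block x : 'I_n := Ordinal (tensor_block_subproof x).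
Definition tensor_pos x : 'I_m := Ordinal (tensor_pos_subproof x).

Lemma tensor_val_subproof (i : 'I_n) (j : 'I_m) : i * m + j < n * m.
Proof.
apply: (@leq_trans (i.+1 * m)); last by rewrite leq_mul2r ltn_ord orbT.
by rewrite mulSn addnC ltn_add2r.
Qed.

Definition tensor_val (i : 'I_n) (j : 'I_m) : 'I_(n * m) :=
  Ordinal (tensor_val_subproof i j).

Definition tensor_fun t g x : 'I_(n * m) :=
  tensor_val (t (tensor_block x)) (g (tensor_pos x)).

Lemma tensor_fun_inj t g : injective (tensor_fun t g).
Proof.
move=> x y /(congr1 val) /= e.
have m0 := tensor_width_gt0 x.
have ei : t (tensor_block x) = t (tensor_block y).
  apply: val_inj; move/(congr1 (divn^~ m)): e.
  by rewrite !divnMDl // !divn_small // !addn0.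
have ej : g (tensor_pos x) = g (tensor_pos y).
  apply: val_inj; move/(congr1 (modn^~ m)): e.
  by rewrite !modnMDl !modn_small.
move/perm_inj/(congr1 val): ei => /= ei.
move/perm_inj/(congr1 val): ej => /= ej.
by apply: val_inj; rewrite /= (divn_eq x m) ei ej -divn_eq.
Qed.

Definition tensor t g : 'S_(n * m) := perm (@tensor_fun_inj t g).

Lemma tensorE t g (i : 'I_n) (j : 'I_m) :
  tensor t g (tensor_val i j) = tensor_val (t i) (g j).
Proof.
have m0 : 0 < m by apply: leq_trans (ltn_ord j).
rewrite permE /tensor_fun; congr (tensor_val (t _) (g _)); apply: val_inj => /=.
- by rewrite divnMDl // divn_small // addn0.
- by rewrite modnMDl modn_small.
Qed.

End Tensor.

Definition permutation := {n : nat & 'S_n.+1}.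

Definition plen (p : permutation) : nat := (tag p).+1.

(* [is_inflation p s b] means p = s[b_1, ..., b_l]. Blocks are read off as lists of
   values, and w lists one value from each block. *)
Definition is_inflation k (p : 'S_k) l (s : 'S_l) (b : seq permutation) : Prop :=
  let blocks := reshape [seq plen c | c <- b] (word p) in
  [/\ size b = l,
      sumn [seq plen c | c <- b] = k,
      all2 (fun (u : seq nat) (c : permutation) => order_iso u (tagged c)) blocks b
    & forall w : seq nat,
        all2 (fun (a : nat) (u : seq nat) => a \in u) w blocks -> order_iso w s].

Definition block_decompositions k (p : 'S_k) :
    set (permutation * seq permutation) :=
  [set x : permutation * seq permutation | is_inflation p (tagged x.1) x.2].

Lemma nth_word n (p : 'S_n) (i : 'I_n) : nth 0 (word p) i = p i.
Proof. by rewrite (nth_map i) ?size_enum_ord // nth_ord_enum. Qed.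

Lemma tensor_is_inflation n m (t : 'S_n) (g : 'S_m.+1) :
  is_inflation (tensor t g) t (nseq n (Tagged (fun m => 'S_m.+1) g)).
Proof.
pose c : permutation := Tagged (fun m => 'S_m.+1) g; rewrite -/c.
have sz : size (word (tensor t g)) = n * m.+1.
  by rewrite size_map size_enum_ord.
rewrite /is_inflation map_nseq; set bl := reshape _ _.
have szbl : size bl = n by rewrite size_reshape size_nseq.
have nbl (i : 'I_n) : nth [::] bl i = take m.+1 (drop (i * m.+1) (word (tensor t g))).
  rewrite nth_reshape nth_nseq ltn_ord take_nseq ?(ltnW (ltn_ord i)) //.
  by rewrite sumn_nseq mulnC.
have szi (i : 'I_n) : size (nth [::] bl i) = m.+1.
  rewrite nbl size_takel // size_drop sz -mulnBl.
  by rewrite -{1}[m.+1]mul1n leq_mul2r subn_gt0 ltn_ord orbT.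
have nbl2 (i : 'I_n) (j : 'I_m.+1) : nth 0 (nth [::] bl i) j = t i * m.+1 + g j.
  rewrite nbl nth_take // nth_drop.
  by rewrite -[i * m.+1 + j]/(val (tensor_val i j)) nth_word tensorE.
split; first by rewrite size_nseq.
- by rewrite sumn_nseq mulnC.
- rewrite all2E size_nseq szbl eqxx /=.
  apply/(all_nthP (([::] : seq nat), (c : permutation))) => i; rewrite size_zip size_nseq szbl minnn => lin.
  rewrite nth_zip ?size_nseq //= nth_nseq lin /order_iso.
  rewrite (szi (Ordinal lin)) eqxx /=.
  apply/forallP => j1; apply/forallP => j2.
  by rewrite !(nbl2 (Ordinal lin)) ltn_add2l.
- move=> w; rewrite all2E szbl => /andP[/eqP sw /(all_nthP (0, [::]))].
  rewrite size_zip szbl sw minnn => hw; rewrite /order_iso sw eqxx /=.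
  have wE (i : 'I_n) : exists j : 'I_m.+1, nth 0 w i = t i * m.+1 + g j.
    have := hw i (ltn_ord i); rewrite nth_zip ?sw //= => /(nthP 0)[j].
    by rewrite szi => jm <-; exists (Ordinal jm); rewrite -nbl2.
  have lt_block (a b : nat) (u v : 'I_m.+1) :
      a < b -> a * m.+1 + u < b * m.+1 + v.
    move=> ab; apply: (@leq_trans (b * m.+1)); last exact: leq_addr.
    apply: (@leq_trans (a.+1 * m.+1)); last by rewrite leq_mul2r ab orbT.
    by rewrite mulSn addnC ltn_add2r.
  apply/forallP => i1; apply/forallP => i2.
  have [->|] := eqVneq i1 i2; first by rewrite !ltnn.
  have [j1 ->] := wE i1; have [j2 ->] := wE i2; rewrite -(inj_eq (@perm_inj _ t)).
  rewrite -val_eqE /=; case: (ltngtP (t i1) (t i2)) => // h _; apply/eqP.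
    by rewrite lt_block.
  by apply/negbTE; rewrite -leqNgt ltnW // lt_block.
Qed.

Lemma finite_block_decompositions k (p : 'S_k) :
  finite_set (block_decompositions p).
Proof.
pose U := {i : 'I_k.+1 & 'S_i.+1}.
pose f (u : U) : permutation := Tagged (fun n => 'S_n.+1) (tagged u).
have f_surj (c : permutation) : plen c <= k -> exists u, f u = c.
  case: c => n c; rewrite /plen /= => nk.
  by exists (Tagged (fun i : 'I_k.+1 => 'S_i.+1) (i := Ordinal (ltnW nk : n < k.+1)) c).
pose g (v : U * {i : 'I_k.+1 & i.-tuple U}) := (f v.1, map f (tagged v.2)).
apply: (@sub_finite_set _ _ (range g)); last first.
  by apply: finite_image; exact: finite_finset.
move=> [s b] [/= sb sk _ _].
have le_sum (h : seq permutation) c : c \in h -> plen c <= sumn [seq plen c | c <- h].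
  elim: h => //= a h ih; rewrite inE => /orP[/eqP->|/ih]; first exact: leq_addr.
  by move=> /leq_trans -> //; exact: leq_addl.
have le_size (h : seq permutation) : size h <= sumn [seq plen c | c <- h].
  by elim: h => //= a h ih; rewrite -add1n leq_add.
have [u us] : exists u, f u = s by apply: f_surj; rewrite -sk /plen -sb le_size.
have [h hb] : exists h, map f h = b.
  have : forall c, c \in b -> plen c <= k by move=> c /le_sum; rewrite sk.
  elim: b {sb sk} => [|c b ih] hk; first by exists [::].
  have [|h hb] := ih; first by move=> d db; apply: hk; rewrite inE db orbT.
  have [|v vc] := f_surj c; first by apply: hk; rewrite mem_head.
  by exists (v :: h); rewrite /= vc hb.
have hs : size h < k.+1 by rewrite ltnS -(size_map f) hb -sk le_size.
exists (u, Tagged (fun i : 'I_k.+1 => i.-tuple U) (i := Ordinal hs) (in_tuple h)) => //.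
by rewrite /g /= us hb.
Qed.

Definition uniform_perm (d : measure_display) (T : measurableType d)
    (R : realType) (P : probability T R) l (X : T -> 'S_l) : Prop :=
  forall s : 'S_l, measurable (X @^-1` [set s]) /\
    P (X @^-1` [set s]) = ((l`!%:R : R)^-1)%:E.

(* Main.v *)
From mathcomp Require Import finmap.
Require Import Defs.
From mathcomp Require Import all_boot all_order all_fingroup all_algebra.
From mathcomp Require Import all_classical all_reals all_analysis.
From mathcomp Require Import ring lra.
Import Order.TTheory GRing.Theory Num.Theory.
Import numFieldNormedType.Exports.
Local Open Scope classical_set_scope.
Local Open Scope ring_scope.

Set Implicit Arguments.
Unset Strict Implicit.
Unset Printing Implicit Defensive.

(** The proof separates an exact count from a statement about a uniformly random
    permutation.

    Exact count. A set of positions of [tensor t g] meets some of the blocks of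
    the tensor product, and is the same thing as a choice of those blocks
    together with a nonempty set of positions of [g] for each of them. The
    pattern it induces is then the inflation of the pattern that [t] induces on
    the chosen blocks by the patterns that [g] induces in them
    ([copy_type_inflation]). Each set of positions determines these patterns, so
    the copies of [p] are sorted by the block decompositions of [p]. With #(q, u)
    for the number of copies of q in u, [pattern_count_tensor] says that

      #(p, tensor t g) = sum over (s, b) of #(s, t) * prod_i #(b_i, g).

    Uniform permutations. It remains to see that the density of a pattern q of
    length k in a uniform permutation of length l tends almost surely to 1/k!
    ([ae_density_cvg]). Nothing relates the permutations of different lengths,
    so the deviations have to be summable, and the second moment, of order 1/l,
    does not suffice; the fourth moment is of order 1/l^2
    ([density_fourth_moment]). Indeed the density minus 1/k! is an average, over
    the k-sets A of positions, of centred variables, and the patterns at disjoint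
    sets of positions are independent. Hence in the expansion of the fourth
    power a product over (A, B, C, D) contributes only if none of the four sets
    is disjoint from the three others ([sum_dev4_le]). Two k-sets meet with
    probability at most k^2/l and this condition forces two such coincidences,
    so a proportion O(1/l^2) of the quadruples is left ([quad_sum_clustered]).
    The Markov inequality and the Borel-Cantelli lemma conclude.

    Limit. Divide the count by 'C(n l, k) and use that 'C(l, m) / l^m tends to
    1/m! ([cvg_bin_expn]) and that the lengths in b add up to k: each b_i
    contributes 1/|b_i|! from the binomial and 1/|b_i|! from the density. *)

(** * Order types of words *)

Section Patterns.
Local Open Scope set_scope.
Local Open Scope nat_scope.

Lemma size_word k (p : 'S_k) : size (word p) = k.
Proof. by rewrite size_map size_enum_ord. Qed.

Lemma size_restriction n (t : 'S_n) (A : {set 'I_n}) :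
  size (restriction t A) = #|A|.
Proof. by rewrite size_map -cardE. Qed.

Lemma uniq_restriction n (t : 'S_n) (A : {set 'I_n}) : uniq (restriction t A).
Proof. by rewrite map_inj_uniq ?enum_uniq // => i j /val_inj/perm_inj. Qed.

Lemma order_isoP s k (p : 'S_k) :
  reflect (size s = k /\ forall x y, x < k -> y < k ->
             (nth 0 s x < nth 0 s y) = (nth 0 (word p) x < nth 0 (word p) y))
          (order_iso s p).
Proof.
apply: (iffP andP) => -[].
  move=> /eqP sk /forallP h; split=> // x y xk yk.
  have /forallP/(_ (Ordinal yk))/eqP := h (Ordinal xk).
  by rewrite -!nth_word.
move=> -> h; split=> //; apply/forallP => i; apply/forallP => j.
by rewrite h // !nth_word.
Qed.

Lemma card_lt_ord k m : m <= k -> #|[set j : 'I_k | j < m]| = m.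
Proof.
by move=> mk; rewrite -sum1dep_card -(big_ord_widen _ (fun=> 1) mk) sum1_card card_ord.
Qed.

(** The value of a permutation at [i] is the number of its smaller values, which
    the order type of the word already determines. *)
Lemma order_iso_inj s k (p q : 'S_k) : order_iso s p -> order_iso s q -> p = q.
Proof.
move=> /order_isoP[_ hp] /order_isoP[_ hq].
have valE (r : 'S_k) i : r i = #|[set j | r j < r i]| :> nat.
  transitivity #|[set j : 'I_k | j < r i]|.
    by rewrite card_lt_ord // ltnW.
  rewrite -(card_preimset [set j : 'I_k | j < r i] (@perm_inj _ r)).
  by apply: eq_card => j; rewrite !inE.
apply/permP => i; apply: val_inj.
apply: etrans (valE p i) (etrans _ (esym (valE q i))).
by apply: eq_card => j; rewrite !inE -!nth_word -hp // hq.
Qed.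

(** The rank of an entry counts the smaller entries. *)
Lemma order_iso_exists s : uniq s -> exists p : 'S_(size s), order_iso s p.
Proof.
move=> us; pose S i := [set j : 'I_(size s) | nth 0 s j < nth 0 s i].
have SP (i : 'I_(size s)) : #|S i| < size s.
  rewrite -[X in _ < X]card_ord; apply: proper_card; apply/properP.
  split; last by exists i; rewrite // !inE ltnn.
  by apply/fintype.subsetP => j; rewrite inE.
have Slt (i j : 'I_(size s)) : nth 0 s i < nth 0 s j -> #|S i| < #|S j|.
  move=> ij; apply: proper_card; apply/properP; split.
    by apply/fintype.subsetP => x; rewrite !inE => /ltn_trans; exact.
  by exists i; rewrite !inE ?ltnn.
have SltE (i j : 'I_(size s)) : (#|S i| < #|S j|) = (nth 0 s i < nth 0 s j).
  apply/idP/idP => [|/Slt//]; apply: contraTT; rewrite -!leqNgt.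
  rewrite leq_eqVlt nth_uniq // => /orP[/eqP/val_inj->//|/Slt/ltnW//].
pose r i : 'I_(size s) := Ordinal (SP i).
have r_inj : injective r.
  move=> i j e; have {}e : #|S i| = #|S j| := congr1 val e.
  have := SltE j i; have := SltE i j; rewrite e ltnn => /esym h1 /esym h2.
  have /eqP : nth 0 s i = nth 0 s j.
    by case: ltngtP h1 h2.
  by rewrite nth_uniq // => /eqP/val_inj.
exists (perm r_inj); rewrite /order_iso eqxx /=.
by apply/forallP => i; apply/forallP => j; rewrite !permE /= SltE.
Qed.

Lemma order_iso_existsS s : uniq s -> s != [::] ->
  exists c : permutation, order_iso s (tagged c).
Proof.
case: s => // a s us _; have [p sp] := order_iso_exists us.
by exists (Tagged (fun m => 'S_m.+1) p).
Qed.

Lemma order_iso_size s k (p : 'S_k) : order_iso s p -> size s = k.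
Proof. by case/andP => /eqP. Qed.

Lemma permutation_inj s (c d : permutation) :
  order_iso s (tagged c) -> order_iso s (tagged d) -> c = d.
Proof.
case: c d => [m c] [m' d] /= hc hd.
have [mm'] : m.+1 = m'.+1 by rewrite -(order_iso_size hc) (order_iso_size hd).
by case: m' / mm' d hd => d /(order_iso_inj hc) ->.
Qed.

End Patterns.

(** * Inflations, position by position *)

Section Inflation.
Local Open Scope set_scope.
Local Open Scope nat_scope.

Lemma all2_nthP (S T : Type) (r : S -> T -> bool) x0 y0 s t :
  reflect (size s = size t /\ forall i, i < size t -> r (nth x0 s i) (nth y0 t i))
          (all2 r s t).
Proof.
rewrite all2E; apply: (iffP andP) => -[].
  move=> /eqP st /(all_nthP (x0, y0)) h; split=> // i it.
  by have := h i; rewrite size_zip st minnn nth_zip //= => /(_ it).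
move=> st h; split; first exact/eqP.
apply/(all_nthP (x0, y0)) => i; rewrite size_zip st minnn nth_zip //=.
exact: h.
Qed.

(** The order on positions that [s[b_1, ..., b_l]] must induce: positions of one
    block compare as in that block, positions of distinct blocks as the blocks
    do in [s]. *)
Definition inflation_lt l (s : 'S_l) (b : seq permutation) (x y : nat) : bool :=
  let sh := [seq plen c | c <- b] in
  let blocks := [seq word (tagged c) | c <- b] in
  let u := reshape_index sh x in let v := reshape_index sh y in
  if u == v then nth 0 (nth [::] blocks u) (reshape_offset sh x)
                 < nth 0 (nth [::] blocks v) (reshape_offset sh y)
  else nth 0 (word s) u < nth 0 (word s) v.

(** A block is read off at the positions that [flatten_index] assigns to it, and
    a comparison between two blocks is witnessed by any word that picks the two
    entries in question. *)
Lemma is_inflationP k (p : 'S_k) l (s : 'S_l) (b : seq permutation) :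
  is_inflation p s b <->
  [/\ size b = l, sumn [seq plen c | c <- b] = k
    & forall x y, x < k -> y < k ->
        (nth 0 (word p) x < nth 0 (word p) y) = inflation_lt s b x y].
Proof.
rewrite /is_inflation /inflation_lt; set sh := [seq plen c | c <- b].
set bl := reshape _ _.
pose c0 : permutation := Tagged (fun m => 'S_m.+1) (1%g : 'S_1).
have szbl : size bl = size b by rewrite size_reshape size_map.
have nsh u : u < size b -> nth 0 sh u = plen (nth c0 b u).
  by move=> ub; rewrite (nth_map c0).
have nW u : u < size b ->
    nth [::] [seq word (tagged c) | c <- b] u = word (tagged (nth c0 b u)).
  by move=> ub; rewrite (nth_map c0).
have sz u : sumn sh = k -> u < size b -> size (nth [::] bl u) = nth 0 sh u.
  move=> shk ub; rewrite -[in RHS](@reshapeKl _ sh (word p)) ?size_word ?shk //.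
  by rewrite (nth_map [::]) // szbl.
have nw x : sumn sh = k -> x < k -> nth 0 (word p) x =
    nth 0 (nth [::] bl (reshape_index sh x)) (reshape_offset sh x).
  move=> shk xk; rewrite -{1}(@reshapeKr _ sh (word p)) ?size_word ?shk //.
  by rewrite nth_flatten reshapeKl // size_word shk.
have idx x : sumn sh = k -> x < k -> reshape_index sh x < size b.
  by move=> shk xk; rewrite -(size_map plen) reshape_indexP // shk.
have off x : sumn sh = k -> x < k ->
    reshape_offset sh x < nth 0 sh (reshape_index sh x).
  by move=> shk xk; rewrite reshape_offsetP // shk.
have fl u i : sumn sh = k -> i < nth 0 sh u -> flatten_index sh u i < k.
  by move=> <-; exact: flatten_indexP.
split=> -[sb shk]; last first.
  move=> h; split=> //.
    apply/(all2_nthP _ [::] c0); split=> // u ub; apply/order_isoP; split.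
      by rewrite sz // nsh.
    move=> x y xc yc.
    have xu : x < nth 0 sh u by rewrite nsh.
    have yu : y < nth 0 sh u by rewrite nsh.
    have := h (flatten_index sh u x) (flatten_index sh u y).
    rewrite !fl // => /(_ isT isT).
    rewrite !nw ?fl // !flatten_indexKl // !flatten_indexKr //.
    by rewrite eqxx nW.
  move=> w /(all2_nthP _ 0 [::])[]; rewrite szbl => sw hw.
  apply/order_isoP; split; first by rewrite sw.
  have wP u : u < l -> exists2 x, x < nth 0 sh u &
      nth 0 w u = nth 0 (word p) (flatten_index sh u x).
    move=> ul; have ub : u < size b by rewrite sb.
    have /(nthP 0)[x xu <-] := hw u ub; exists x; first by rewrite -sz.
    rewrite sz // in xu.
    by rewrite nw ?fl // flatten_indexKl // flatten_indexKr.
  move=> u v ul vl; have [->|uv] := eqVneq u v; first by rewrite !ltnn.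
  have [x xu ->] := wP u ul; have [y yv ->] := wP v vl.
  rewrite h ?fl // !flatten_indexKl //.
  by rewrite (negbTE uv).
move=> /(all2_nthP _ [::] c0)[_ hb] hw; split=> // x y xk yk.
rewrite !nw //; have [uv|uv] := eqVneq; last first.
  pose u := reshape_index sh x; pose v := reshape_index sh y.
  pose i := reshape_offset sh x; pose j := reshape_offset sh y.
  (* A transversal through the entries at x and y; any entry of the other blocks
     will do. *)
  pose w := mkseq (fun r => nth 0 (nth [::] bl r)
    (if r == u then i else if r == v then j else 0)) l.
  have /order_isoP[_ hws] : order_iso w s.
    apply: hw; apply/(all2_nthP _ 0 [::]); rewrite size_mkseq szbl.
    split=> // r rb; rewrite nth_mkseq -?sb //; apply: mem_nth.
    rewrite sz //; case: eqP => [->|_]; first exact: off.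
    case: eqP => [->|_]; first exact: off.
    by rewrite nsh.
  have ul : u < l by rewrite -sb idx.
  have vl : v < l by rewrite -sb idx.
  by rewrite -hws // !nth_mkseq // !eqxx [v == u]eq_sym (negbTE uv).
have ub := idx _ shk yk; rewrite uv nW //.
have /order_isoP[_] := hb _ ub.
apply; rewrite -[X in _ < X]/(plen _) -nsh //; last exact: off.
by rewrite -uv off.
Qed.

(** [inflation_lt] leaves no freedom in the order type, so a word that follows it
    is order-isomorphic to [p] exactly when [p] follows it too. *)
Lemma order_iso_inflation k (p : 'S_k) l (s : 'S_l) (b : seq permutation) w :
  size b = l -> size w = sumn [seq plen c | c <- b] ->
  (forall x y, x < size w -> y < size w ->
     (nth 0 w x < nth 0 w y) = inflation_lt s b x y) ->
  order_iso w p <-> is_inflation p s b.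
Proof.
move=> sb sw hw; rewrite is_inflationP; split.
  by move=> /order_isoP[wk h]; split=> // [|x y xk yk]; rewrite -?h ?hw -?sw ?wk.
move=> [_ bk h]; apply/order_isoP; rewrite sw; split=> // x y xk yk.
by rewrite h // hw // sw bk.
Qed.

End Inflation.

(** * Copies in a tensor product *)

Section TensorSubsets.
Local Open Scope set_scope.
Local Open Scope nat_scope.
Variables n l : nat.
Implicit Types f : {ffun 'I_n -> {set 'I_l}}.

Definition tensor_set f : {set 'I_(n * l)} :=
  [set x | tensor_pos x \in f (tensor_block x)].

(** The blocks that [tensor_set f] meets. *)
Definition supp f : {set 'I_n} := [set i | f i != finset.set0].

Lemma tensor_blockE i j : @tensor_block n l (tensor_val i j) = i.
Proof.
apply: val_inj; rewrite /= divnMDl ?divn_small ?addn0 //.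
exact: leq_ltn_trans (ltn_ord j).
Qed.

Lemma tensor_posE i j : @tensor_pos n l (tensor_val i j) = j.
Proof. by apply: val_inj; rewrite /= modnMDl modn_small. Qed.

Lemma tensor_valK (x : 'I_(n * l)) :
  tensor_val (tensor_block x) (tensor_pos x) = x.
Proof. by apply: val_inj; rewrite /= -divn_eq. Qed.

Lemma tensor_set_bij : bijective tensor_set.
Proof.
exists (fun A : {set 'I_(n * l)} => [ffun i => [set j | tensor_val i j \in A]]).
  move=> f; apply/ffunP => i; apply/finset.setP => j.
  by rewrite ffunE !inE tensor_blockE tensor_posE.
by move=> A; apply/finset.setP => x; rewrite !inE ffunE inE tensor_valK.
Qed.

Lemma pairwise_enum_ord m (A : {set 'I_m}) :
  pairwise (fun x y : 'I_m => x < y) (enum A).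
Proof.
rewrite /enum_mem -enumT; apply: pairwise_filter.
rewrite -(pairwise_map val ltn) val_enum_ord.
by rewrite -(sorted_pairwise ltn_trans) iota_ltn_sorted.
Qed.

(** Both lists increase: the blocks are consecutive intervals of positions. *)
Lemma enum_tensor_set f : enum (tensor_set f) =
  flatten [seq [seq tensor_val i j | j <- enum (f i)] | i <- enum (supp f)].
Proof.
have ltt : transitive (fun x y : 'I_(n * l) => x < y).
  by move=> y x z; exact: ltn_trans.
apply: (irr_sorted_eq ltt).
- by move=> x; rewrite /= ltnn.
- by rewrite sorted_pairwise // pairwise_enum_ord.
- rewrite sorted_pairwise //; have := pairwise_enum_ord (supp f).
  elim: (enum (supp f)) => //= i s ih /andP[/allP is_ /ih {}ih].
  rewrite pairwise_cat ih andbT; apply/andP; split; last first.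
    rewrite pairwise_map; apply: sub_pairwise (pairwise_enum_ord (f i)).
    by move=> j1 j2 /=; rewrite ltn_add2l.
  apply/allrelP => x y /mapP[j _ ->] /flatten_mapP[i' /is_ ii'] /mapP[j' _ ->] /=.
  apply: (@leq_trans (i.+1 * l)); first by rewrite mulSn addnC ltn_add2r.
  by rewrite (leq_trans _ (leq_addr _ _)) // leq_mul2r ii' orbT.
move=> x; rewrite mem_enum inE; apply/idP/flatten_mapP => [xf|].
  exists (tensor_block x).
    by rewrite mem_enum inE; apply/set0Pn; exists (tensor_pos x).
  by apply/mapP; exists (tensor_pos x); rewrite ?mem_enum ?tensor_valK.
move=> [i _ /mapP[j]]; rewrite mem_enum => jf ->.
by rewrite tensor_blockE tensor_posE.
Qed.

Lemma restriction_tensor (t : 'S_n) (g : 'S_l) f :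
  restriction (tensor t g) (tensor_set f) =
  flatten [seq [seq t i * l + z | z <- restriction g (f i)] | i <- enum (supp f)].
Proof.
rewrite /restriction enum_tensor_set map_flatten -map_comp; congr flatten.
apply: eq_map => i /=; rewrite -!map_comp; apply: eq_map => j /=.
by rewrite tensorE.
Qed.

(** [x] lists what the set of positions [tensor_set f] induces: the pattern of
    the blocks it meets, then the pattern inside each of them. *)
Definition copy_type (t : 'S_n) (g : 'S_l) f
    (x : permutation * seq permutation) : bool :=
  order_iso (restriction t (supp f)) (tagged x.1) &&
  all2 (fun u c => order_iso u (tagged c))
       [seq restriction g (f i) | i <- enum (supp f)] x.2.

Lemma copy_type_inj t g f x y : copy_type t g f x -> copy_type t g f y -> x = y.
Proof.
case: x y => [s b] [s' b'] /andP[/= hs hb] /andP[/= hs' hb'].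
rewrite (permutation_inj hs hs'); congr pair.
elim: [seq _ | _ <- _] b b' hb hb' => [|i e ih] [|c b] [|c' b'] //=.
by move=> /andP[hc /ih hb] /andP[hc' /hb ->]; rewrite (permutation_inj hc hc').
Qed.

Lemma copy_type_exists t g f : supp f != finset.set0 -> exists x, copy_type t g f x.
Proof.
move=> f0; have [|s hs] := order_iso_existsS (uniq_restriction t (supp f)).
  by rewrite -size_eq0 size_restriction cards_eq0.
suff [b hb] : exists b : seq permutation,
    all2 (fun u c => order_iso u (tagged c))
      [seq restriction g (f i) | i <- enum (supp f)] b.
  by exists (s, b); rewrite /copy_type hs.
have : {subset enum (supp f) <= supp f} by move=> i; rewrite mem_enum.
elim: (enum _) => [|i e ih] he; first by exists [::].
have [|b hb] := ih; first by move=> j je; apply: he; rewrite inE je orbT.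
have [|c hc] := order_iso_existsS (uniq_restriction g (f i)).
  rewrite -size_eq0 size_restriction cards_eq0.
  by have := he i (mem_head _ _); rewrite inE.
by exists (c :: b); rewrite /= hc.
Qed.

(** Values in distinct blocks of the tensor product compare as the blocks do in
    [t], and values in one block as in [g]; this is the order that the inflation
    described by [x] requires. *)
Lemma copy_type_inflation k (p : 'S_k) t g f x : copy_type t g f x ->
  order_iso (restriction (tensor t g) (tensor_set f)) p <->
  is_inflation p (tagged x.1) x.2.
Proof.
case: x => s b /andP[/= /order_isoP[ssz hs]].
pose c0 : permutation := Tagged (fun m => 'S_m.+1) (1%g : 'S_1).
move=> /(all2_nthP _ [::] c0)[]; set ws := [seq restriction g _ | _ <- _].
move=> bsz hb; set a := restriction t (supp f) in ssz hs.
have i0 : 'I_n by move: ssz; rewrite /a /restriction; case: (enum (supp f)).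
have asz : size a = size b by rewrite -bsz /a /restriction !size_map.
set ss := [seq [seq t i * l + z | z <- restriction g (f i)] | i <- enum (supp f)].
have nss u : u < size b ->
    nth [::] ss u = [seq nth 0 a u * l + z | z <- nth [::] ws u].
  rewrite -asz size_map => ub.
  by rewrite (nth_map i0) // /ws (nth_map i0 [::]) // /a /restriction (nth_map i0).
have shb : shape ss = [seq plen c | c <- b].
  apply: (@eq_from_nth _ 0); rewrite !size_map; first by rewrite -asz size_map.
  move=> u; rewrite -(size_map (fun i => val (t i)) (enum _)) -/a asz => ub.
  rewrite (nth_map [::]) ?(nth_map c0) //; last first.
    by rewrite size_map -(size_map (fun i => val (t i))) -/a asz.
  by rewrite nss // size_map (order_iso_size (hb u ub)).
have wsl u z : u < size b -> z \in nth [::] ws u -> z < l.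
  rewrite -bsz size_map => ub; rewrite (nth_map i0) // => /mapP[j _ ->].
  exact: ltn_ord.
have sw : size (flatten ss) = sumn [seq plen c | c <- b].
  by rewrite size_flatten shb.
rewrite restriction_tensor; apply: order_iso_inflation => //.
  by rewrite -asz.
move=> x y; rewrite sw => xk yk; rewrite !nth_flatten shb /inflation_lt.
set sh := [seq plen c | c <- b] in xk yk *.
have ub : reshape_index sh x < size b by rewrite -(size_map plen) reshape_indexP.
have vb : reshape_index sh y < size b by rewrite -(size_map plen) reshape_indexP.
have := reshape_offsetP xk; have := reshape_offsetP yk.
move: (reshape_index sh x) (reshape_index sh y) ub vb => u v ub vb.
move: (reshape_offset sh x) (reshape_offset sh y) => i j.
rewrite !(nth_map c0) // => jv iu.
have /order_isoP[szu hu] := hb u ub; have /order_isoP[szv hv] := hb v vb.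
rewrite !nss // !(nth_map 0) ?szu ?szv //.
have [e|uv] := eqVneq u v.
  by rewrite -e in jv *; rewrite ltn_add2l hu.
have lu : nth 0 (nth [::] ws u) i < l by rewrite (wsl u) // mem_nth ?szu.
have lv : nth 0 (nth [::] ws v) j < l by rewrite (wsl v) // mem_nth ?szv.
have au : nth 0 a u != nth 0 a v by rewrite nth_uniq ?asz ?uniq_restriction.
have lt_block (q r q' r' : nat) : q < q' -> r < l -> q * l + r < q' * l + r'.
  move=> qq' rl; apply: (@leq_trans (q.+1 * l)).
    by rewrite mulSn addnC ltn_add2r.
  by rewrite (leq_trans _ (leq_addr _ _)) // leq_mul2r qq' orbT.
rewrite -hs -?ssz ?asz //.
case: (ltngtP (nth 0 a u) (nth 0 a v)) au => // h _; first by rewrite lt_block.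
by apply/negbTE; rewrite -leqNgt ltnW // lt_block.
Qed.

End TensorSubsets.

(** * Counting copies *)

Section PatternCount.
Local Open Scope set_scope.
Local Open Scope nat_scope.

Definition pattern_count k m (p : 'S_k) (t : 'S_m) : nat :=
  #|[set A : {set 'I_m} | order_iso (restriction t A) p]|.

(** Once the blocks [I] are fixed, the sets of positions inside them are chosen
    independently of each other. *)
Lemma card_copy_type n l (t : 'S_n) (g : 'S_l) (x : permutation * seq permutation) :
  size x.2 = plen x.1 ->
  #|[set f | copy_type t g f x]| =
  pattern_count (tagged x.1) t * \prod_(c <- x.2) pattern_count (tagged c) g.
Proof.
case: x => s b /= sb; pose c0 : permutation := Tagged (fun m => 'S_m.+1) (1%g : 'S_1).
rewrite /pattern_count -[X in X * _]sum1_card big_distrl /=.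
rewrite -sum1_card (partition_big (@supp n l)
  (fun I => I \in [set I : {set 'I_n} | order_iso (restriction t I) (tagged s)]));
  last by move=> f; rewrite !inE => /andP[].
apply: eq_bigr => I; rewrite inE => Is; rewrite mul1n.
have szI : size (enum I) = size b.
  by rewrite sb /plen -(order_iso_size Is) size_map.
(* The admissible choices in block i; the block at rank r of I carries the entry
   of rank r of b, and a block outside I stays empty. *)
pose F (i : 'I_n) : pred {set 'I_l} := if i \in I
  then [pred A | order_iso (restriction g A) (tagged (nth c0 b (index i (enum I))))]
  else pred1 finset.set0.
transitivity #|family F|.
  rewrite sum1dep_card; apply: eq_card => f; rewrite !inE.
  apply/andP/familyP => [[/andP[_ /(all2_nthP _ [::] c0)[_ fb]] /eqP fI] i|fF].
    rewrite /F; case: ifP => [iI|/negbT].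
      have ib : index i (enum I) < size b by rewrite -szI index_mem mem_enum.
      have := fb _ ib; rewrite (nth_map i) fI ?szI //.
      by rewrite nth_index ?mem_enum.
    by rewrite -fI !inE negbK.
  have fI : supp f = I.
    apply/finset.setP => i; rewrite inE; have := fF i; rewrite /F.
    case: ifP => [_|_]; last by rewrite inE => /eqP ->; rewrite eqxx.
    by rewrite inE => /order_iso_size; rewrite size_restriction -card_gt0 => ->.
  split; last exact/eqP.
  rewrite /copy_type fI Is /=; apply/(all2_nthP _ [::] c0).
  rewrite size_map; split=> // u ub.
  have i0 : 'I_n by move: ub; rewrite -szI; case: (enum I).
  rewrite (nth_map i0) ?szI //; have := fF (nth i0 (enum I) u).
  have uI : nth i0 (enum I) u \in I by rewrite -mem_enum mem_nth ?szI.
  by rewrite /F uI inE index_uniq ?szI ?enum_uniq.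
rewrite card_family foldrE big_map big_enum /= (bigID (fun i => i \in I)) /=.
rewrite [X in _ * X]big1 ?muln1; last first.
  by move=> i /negbTE iI; rewrite /F iI card1.
rewrite -big_enum /= [RHS](big_nth c0) -szI big_mkord.
case: (posnP (size (enum I))) => [z|z].
  by rewrite (size0nil z) big_nil big_ord0.
have i0 : 'I_n by move: z; case: (enum I).
rewrite (big_nth i0) big_mkord; apply: eq_bigr => u _.
have uI : nth i0 (enum I) u \in I by rewrite -mem_enum mem_nth.
rewrite /F uI index_uniq ?enum_uniq //.
by apply: eq_card => A; rewrite !inE.
Qed.

Lemma sum_nat_count (T : Type) (a : pred T) (s : seq T) :
  \sum_(x <- s) (a x : nat) = count a s.
Proof. by rewrite -sum1_count [RHS]big_mkcond; apply: eq_bigr => x _; case: (a x). Qed.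

(** Every nonempty set of positions has exactly one type, and it is a copy of [p]
    when that type is a block decomposition of [p]. *)
Lemma pattern_count_tensor n l k (t : 'S_n) (g : 'S_l) (p : 'S_k) : 0 < k ->
  pattern_count p (tensor t g) =
  \sum_(x <- fset_set (block_decompositions p))
     pattern_count (tagged x.1) t * \prod_(c <- x.2) pattern_count (tagged c) g.
Proof.
move=> k_gt0; set D := fset_set _.
have DE x : (x \in D) = (x \in block_decompositions p).
  by rewrite in_fset_set //; exact: finite_block_decompositions.
transitivity (\sum_(x <- D) #|[set f | copy_type t g f x]|); last first.
  apply: eq_big_seq => x; rewrite DE inE => -[sx _ _ _].
  exact: card_copy_type.
transitivity #|[set f | order_iso (restriction (tensor t g) (tensor_set f)) p]|.
  rewrite /pattern_count -(on_card_preimset (onW_bij _ (tensor_set_bij n l))).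
  by apply: eq_card => f; rewrite !inE.
rewrite -sum1dep_card big_mkcond /=.
under [RHS]eq_bigr => x _ do rewrite -sum1dep_card big_mkcond /=.
rewrite exchange_big /=; apply: eq_bigr => f _.
transitivity (\sum_(x <- D) (copy_type t g f x : nat)); last first.
  by apply: eq_bigr => x _; case: copy_type.
rewrite sum_nat_count.
have [f0|fN0] := eqVneq (supp f) finset.set0.
  rewrite ifF; last first.
    apply/negP => /order_iso_size; rewrite restriction_tensor f0 enum_set0 /=.
    by move=> k0; rewrite -k0 in k_gt0.
  apply/esym/eqP; rewrite -leqn0 leqNgt -has_count; apply/hasPn => x _.
  apply/negP => /andP[/order_iso_size]; rewrite size_restriction f0.
  by rewrite cards0.
have [x0 hx0] := copy_type_exists t g fN0.
have -> : count (copy_type t g f) D = count_mem x0 D.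
  apply: eq_count => x /=; apply/idP/eqP => [/copy_type_inj|-> //]; exact.
rewrite count_uniq_mem ?fset_uniq // DE.
have := copy_type_inflation p hx0.
case: ifP => [_ [/(_ isT) h _]|_ [_ h]]; first by rewrite mem_set.
by rewrite memNset // => /h.
Qed.

End PatternCount.

(** * Patterns at disjoint sets of positions are independent *)

Section Moment.
Local Open Scope set_scope.
Local Open Scope ring_scope.
Variables (R : realType) (l k : nat) (q : 'S_k).
Implicit Types (A B C : {set 'I_l}) (s : 'S_l).

(** The permutation [vh] acts on the increasing enumeration of [A] as [v] acts on
    its indices, so it composes the pattern at [A] with [v]. *)
Lemma permute_positions A (v : 'S_k) : #|A| = k ->
  exists vh : 'S_l,
    (forall s, order_iso (restriction (vh * s)%g A) (v * q)%g =
               order_iso (restriction s A) q) /\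
    {in ~: A, vh =1 id}.
Proof.
move=> Ak; have szA : size (enum A) = k by rewrite -cardE.
pose f (x : 'I_l) : 'I_l :=
  if insub (index x (enum A)) is Some i then nth x (enum A) (v i) else x.
have fA (a : 'I_l) (i : 'I_k) : f (nth a (enum A) i) = nth a (enum A) (v i).
  rewrite /f index_uniq ?enum_uniq ?szA // valK.
  by apply: set_nth_default; rewrite szA.
have fN x : x \notin A -> f x = x.
  rewrite -mem_enum -index_mem szA => xA; rewrite /f insubN //.
have nA x : x \in A -> exists i : 'I_k, x = nth x (enum A) i.
  move=> xA; have ik : (index x (enum A) < k)%N by rewrite -szA index_mem mem_enum.
  by exists (Ordinal ik); rewrite nth_index // mem_enum.
have fin x : (f x \in A) = (x \in A).
  have [xA|xA] := boolP (x \in A); last by rewrite fN // (negbTE xA).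
  by have [i ->] := nA x xA; rewrite fA -mem_enum mem_nth // szA.
have f_inj : injective f.
  move=> x y e; have := fin x; rewrite e fin.
  have [xA|xA] := boolP (x \in A) => yA; last first.
    by move: e; rewrite !fN // yA.
  have [i xi] := nA x xA; have [j yj] := nA y yA; move: e; rewrite xi yj !fA.
  rewrite [RHS](set_nth_default x) ?szA // => /eqP.
  rewrite nth_uniq ?szA ?enum_uniq // => /eqP/val_inj/perm_inj ->.
  by apply: set_nth_default; rewrite szA.
exists (perm f_inj); split; last first.
  by move=> x; rewrite inE => xA; rewrite permE fN.
move=> s.
have nth_r (i : 'I_k) : nth 0%N (restriction (perm f_inj * s)%g A) i =
    nth 0%N (restriction s A) (v i).
  have a0 : 'I_l by case: i => i; rewrite -szA; case: (enum A).
  by rewrite !(nth_map a0) ?szA // permM permE fA.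
apply/order_isoP/order_isoP; rewrite !size_restriction => -[_ h]; split=> // x y xk yk.
  have := h _ _ (ltn_ord ((v^-1)%g (Ordinal xk))) (ltn_ord ((v^-1)%g (Ordinal yk))).
  by rewrite !nth_r !nth_word !permM !permKV -!nth_word.
have := h _ _ (ltn_ord (v (Ordinal xk))) (ltn_ord (v (Ordinal yk))).
rewrite -!nth_r !nth_word /= => ->.
by rewrite -[x]/(val (Ordinal xk)) -[y]/(val (Ordinal yk)) !nth_word !permM.
Qed.

(** If [A] has k elements, this is the indicator of a copy of [q] at [A], centred
    for the uniform distribution on 'S_l. *)
Definition dev A s : R := (order_iso (restriction s A) q)%:R - (k`!%:R)^-1.

Lemma restriction_fix (u s : 'S_l) A : {in A, u =1 id} ->
  restriction (u * s)%g A = restriction s A.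
Proof.
by move=> uA; apply/eq_in_map => x; rewrite mem_enum => /uA; rewrite permM => ->.
Qed.

End Moment.

Section Orthogonal.
Local Open Scope set_scope.
Local Open Scope ring_scope.
Variables (R : realType) (l k : nat).
Implicit Types (A B C : {set 'I_l}) (s : 'S_l).

(** Permuting the positions in [A] acts transitively on the patterns at [A], so
    each of the k! patterns carries the same share of a sum that ignores how
    the values are arranged at [A]. *)
Lemma sum_dev_mul (q : 'S_k) A (F : 'S_l -> R) : #|A| = k ->
  (forall u s : 'S_l, {in ~: A, u =1 id} -> F (u * s)%g = F s) ->
  \sum_s dev R q A s * F s = 0.
Proof.
move=> Ak Finv; pose G (r : 'S_k) := \sum_s (order_iso (restriction s A) r)%:R * F s.
have Gconst r : G r = G q.
  have [u [hu uA]] := permute_positions q (r * q^-1)%g Ak.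
  rewrite /G (reindex_inj (mulgI u)) /=; apply: eq_bigr => s _.
  by rewrite Finv // -hu mulgKV.
have sumG : \sum_r G r = \sum_s F s.
  rewrite exchange_big /=; apply: eq_bigr => s _; rewrite -mulr_suml.
  have [] := order_iso_exists (uniq_restriction s A).
  rewrite size_restriction Ak => r0 hr0.
  rewrite (bigD1 r0) //= hr0 big1 ?addr0 ?mul1r // => r rr0.
  by case E: order_iso => //; rewrite (order_iso_inj E hr0) eqxx in rr0.
have k0 : k`!%:R != 0 :> R by rewrite pnatr_eq0 -lt0n fact_gt0.
have {}sumG : \sum_s F s = k`!%:R * G q.
  rewrite -sumG (eq_bigr (fun=> G q)) // sumr_const card_Sn.
  by rewrite mulr_natl.
under eq_bigr => s _ do rewrite mulrBl.
by rewrite sumrB -/(G q) -mulr_sumr sumG mulKf // subrr.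
Qed.

Lemma normr_dev_le1 (q : 'S_k) A s : `|dev R q A s| <= 1.
Proof.
have k1 : 1 <= k`!%:R :> R by rewrite ler1n fact_gt0.
have : 0 <= (k`!%:R)^-1 :> R by rewrite invr_ge0 ler0n.
have : (k`!%:R)^-1 <= 1 :> R by rewrite invf_le1 // (lt_le_trans ltr01).
by rewrite /dev ler_norml; case: order_iso; rewrite /= => *; apply/andP; split; lra.
Qed.

End Orthogonal.

(** * Quadruples of sets that overlap enough *)

Section Meeting.
Local Open Scope set_scope.
Local Open Scope ring_scope.
Variables (R : realType) (l k : nat).
Implicit Types (A B C D : {set 'I_l}).

Local Notation ksets := [set A : {set 'I_l} | #|A| == k].

Definition overlap A B : bool := ~~ [disjoint A & B].

Lemma overlapC A B : overlap A B = overlap B A.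
Proof. by rewrite /overlap disjoint_sym. Qed.

Definition overlap_ind A B : R := (overlap A B)%:R.

Lemma overlap_ind_ge0 A B : 0 <= overlap_ind A B. Proof. exact: ler0n. Qed.

Lemma overlap_indC A B : overlap_ind A B = overlap_ind B A.
Proof. by rewrite /overlap_ind overlapC. Qed.

Lemma card_ksets : \sum_(A in ksets) 1 = 'C(l, k)%:R :> R.
Proof. by rewrite sumr_const card_draws card_ord. Qed.

Lemma sum_mem_ksets x : \sum_(B in ksets) (x \in B)%:R =
  ('C(l, k) - 'C(l.-1, k))%:R :> R.
Proof.
rewrite natrB; last by rewrite leq_bin2l // leq_pred.
rewrite -card_ksets; apply/eqP; rewrite eq_sym subr_eq; apply/eqP.
have -> : 'C(l.-1, k)%:R = \sum_(B in ksets) (x \notin B)%:R :> R.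
  rewrite -natr_sum -big_mkcondr sum1dep_card; congr (_%:R).
  have -> : l.-1 = #|~: [set x]| by rewrite cardsC1 card_ord.
  rewrite -cards_draws; apply: eq_card => B; rewrite !inE andbC; congr andb.
  by rewrite finset.subsetC finset.sub1set inE.
rewrite -big_split /=; apply: eq_bigr => B _.
by case: (x \in B); rewrite ?addr0 ?add0r.
Qed.

(** The k-sets through a given point number 'C(l, k) - 'C(l.-1, k), and a k-set
    has k points. *)
Definition overlap_bound : R := (k * ('C(l, k) - 'C(l.-1, k)))%:R.

Lemma sum_overlap A : A \in ksets -> \sum_(B in ksets) overlap_ind A B <= overlap_bound.
Proof.
rewrite inE => /eqP Ak; rewrite /overlap_bound natrM.
apply: (@le_trans _ _ (\sum_(B in ksets) \sum_(x in A) (x \in B)%:R)).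
  apply: ler_sum => B _; rewrite /overlap_ind /overlap -setI_eq0.
  have [_|] := eqVneq; first by apply: sumr_ge0 => x _; exact: ler0n.
  move=> /set0Pn[x]; rewrite inE => /andP[xA xB].
  rewrite (bigD1 x) //= xB lerDl; apply: sumr_ge0 => y _; exact: ler0n.
rewrite exchange_big /= (eq_bigr (fun=> ('C(l, k) - 'C(l.-1, k))%:R)); last first.
  by move=> x _; exact: sum_mem_ksets.
by rewrite sumr_const Ak mulr_natl.
Qed.

Lemma sum_overlapC B : B \in ksets -> \sum_(A in ksets) overlap_ind A B <= overlap_bound.
Proof. by under eq_bigr => A _ do rewrite overlap_indC; exact: sum_overlap. Qed.

Definition quad_sum (F : {set 'I_l} -> {set 'I_l} -> {set 'I_l} -> {set 'I_l} -> R) : R :=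
  \sum_(A in ksets) \sum_(B in ksets) \sum_(C in ksets) \sum_(D in ksets) F A B C D.

Lemma quad_sumD F G :
  quad_sum (fun A B C D => F A B C D + G A B C D) = quad_sum F + quad_sum G.
Proof. by rewrite /quad_sum; do 4!(rewrite -big_split /=; apply: eq_bigr => ? _). Qed.

(** The sums are bounded from the innermost outwards: [f1], [f2] and [f3] weigh
    the choices of the second, third and fourth set given the previous ones. *)
Lemma quad_sum_le (b1 b2 b3 : R) F
    (f1 : {set 'I_l} -> {set 'I_l} -> R)
    (f2 : {set 'I_l} -> {set 'I_l} -> {set 'I_l} -> R)
    (f3 : {set 'I_l} -> {set 'I_l} -> {set 'I_l} -> {set 'I_l} -> R) :
  0 <= b2 -> 0 <= b3 ->
  (forall A B, 0 <= f1 A B) -> (forall A B C, 0 <= f2 A B C) ->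
  (forall A, A \in ksets -> \sum_(B in ksets) f1 A B <= b1) ->
  (forall A B, A \in ksets -> B \in ksets ->
     \sum_(C in ksets) f2 A B C <= b2) ->
  (forall A B C, A \in ksets -> B \in ksets -> C \in ksets ->
     \sum_(D in ksets) f3 A B C D <= b3) ->
  (forall A B C D, F A B C D = f1 A B * f2 A B C * f3 A B C D) ->
  quad_sum F <= 'C(l, k)%:R * b1 * b2 * b3.
Proof.
move=> b2_ge0 b3_ge0 f1_ge0 f2_ge0 h1 h2 h3 FE.
rewrite -card_ksets -!mulrA mulr_suml; apply: ler_sum => A kA; rewrite mul1r.
apply: (@le_trans _ _ (\sum_(B in ksets) f1 A B * (b2 * b3))); last first.
  by rewrite -mulr_suml ler_wpM2r ?mulr_ge0 ?h1.
apply: ler_sum => B kB.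
apply: (@le_trans _ _ (f1 A B * \sum_(C in ksets) f2 A B C * b3)); last first.
  by rewrite -mulr_suml ler_wpM2l // ler_wpM2r // h2.
rewrite mulr_sumr; apply: ler_sum => C kC.
under eq_bigr => D _ do rewrite FE.
by rewrite -mulr_sumr -mulrA ler_wpM2l // ler_wpM2l // h3.
Qed.

Lemma quad_sum_swap (F : {set 'I_l} -> {set 'I_l} -> {set 'I_l} -> {set 'I_l} -> R) :
  quad_sum F = quad_sum (fun A B C D => F A B D C).
Proof. by apply: eq_bigr => A _; apply: eq_bigr => B _; rewrite exchange_big. Qed.

(** A graph on four vertices without isolated vertex contains a perfect matching
    or is a star. The first three terms stand for the three matchings, the other
    four for the stars at [A], [B], [C] and [D]; of the three edges of a star
    the term keeps two, chosen to suit the order of summation. *)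
Definition clustered A B C D : R :=
  overlap_ind A B * overlap_ind C D + overlap_ind A C * overlap_ind B D +
  overlap_ind A D * overlap_ind B C + overlap_ind A B * overlap_ind A C +
  overlap_ind A B * overlap_ind B C + overlap_ind A C * overlap_ind C D +
  overlap_ind A D * overlap_ind C D.

Lemma quad_sum_clustered :
  quad_sum clustered <= 7 * ('C(l, k)%:R * overlap_bound) ^+ 2.
Proof.
have M0 : 0 <= overlap_bound by exact: ler0n.
have N0 : 0 <= 'C(l, k)%:R :> R by exact: ler0n.
have le1 : \sum_(A in ksets) 1 <= 'C(l, k)%:R :> R by rewrite card_ksets.
have m0 := overlap_ind_ge0.
have one_ge0 : 0 <= 1 :> R by [].
pose N : R := 'C(l, k)%:R; pose M := overlap_bound; rewrite -/N -/M in N0 M0 le1 *.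
have -> : 7 * (N * M) ^+ 2 =
    N * M * N * M + N * N * M * M + N * N * M * M + N * M * M * N +
    N * M * M * N + N * N * M * M + N * N * M * M by ring.
rewrite /clustered !quad_sumD.
have sm := sum_overlap; have smC := sum_overlapC.
do !apply: lerD.
- apply: (quad_sum_le (f1 := fun A B => overlap_ind A B) (f2 := fun _ _ _ => 1)
    (f3 := fun _ _ C D => overlap_ind C D)) => // *; rewrite ?mulr1 //; exact: sm.
- apply: (quad_sum_le (f1 := fun _ _ => 1) (f2 := fun A _ C => overlap_ind A C)
    (f3 := fun _ B _ D => overlap_ind B D)) => // *; rewrite ?mul1r //; exact: sm.
- apply: (quad_sum_le (f1 := fun _ _ => 1) (f2 := fun _ B C => overlap_ind B C)
    (f3 := fun A _ _ D => overlap_ind A D)) => // *; rewrite ?mul1r 1?mulrC //; exact: sm.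
- apply: (quad_sum_le (f1 := fun A B => overlap_ind A B) (f2 := fun A _ C => overlap_ind A C)
    (f3 := fun _ _ _ _ => 1)) => // *; rewrite ?mulr1 //; exact: sm.
- apply: (quad_sum_le (f1 := fun A B => overlap_ind A B) (f2 := fun _ B C => overlap_ind B C)
    (f3 := fun _ _ _ _ => 1)) => // *; rewrite ?mulr1 //; exact: sm.
- apply: (quad_sum_le (f1 := fun _ _ => 1) (f2 := fun A _ C => overlap_ind A C)
    (f3 := fun _ _ C D => overlap_ind C D)) => // *; rewrite ?mul1r //; exact: sm.
(* Both overlaps of the last term involve D, which is therefore chosen before C. *)
rewrite quad_sum_swap.
apply: (quad_sum_le (f1 := fun _ _ => 1) (f2 := fun A _ C => overlap_ind A C)
    (f3 := fun _ _ C D => overlap_ind D C)) => // *; rewrite ?mul1r //; last exact: smC.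
exact: sm.
Qed.

End Meeting.

(** * The fourth moment *)

Section FourthMoment.
Local Open Scope set_scope.
Local Open Scope ring_scope.
Variables (R : realType) (l k : nat) (q : 'S_k).
Implicit Types (A B C D : {set 'I_l}) (s : 'S_l).

Local Notation ksets := [set A : {set 'I_l} | #|A| == k].
Local Notation devq := (dev R q).

Lemma dev_disjoint A B (u s : 'S_l) : ~~ overlap A B -> {in ~: A, u =1 id} ->
  devq B (u * s)%g = devq B s.
Proof.
rewrite negbK => AB uA; rewrite /dev restriction_fix // => x xB; apply: uA.
by rewrite inE (disjointFl AB).
Qed.

Lemma sum_dev_isolated A B C D : #|A| = k ->
  ~~ [|| overlap A B, overlap A C | overlap A D] ->
  \sum_s devq A s * (devq B s * devq C s * devq D s) = 0.
Proof.
move=> Ak; rewrite !negb_or => /and3P[AB AC AD].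
apply: sum_dev_mul => // u s uA.
by rewrite !(dev_disjoint (A := A)).
Qed.

(** Either one of the sets is disjoint from the others and the sum vanishes, or
    the weight on the right is at least 1 and bounds a product of numbers of
    absolute value at most 1. *)
Lemma sum_dev4_le A B C D : A \in ksets -> B \in ksets -> C \in ksets -> D \in ksets ->
  \sum_s devq A s * devq B s * devq C s * devq D s <= l`!%:R * clustered R A B C D.
Proof.
rewrite !inE => /eqP Ak /eqP Bk /eqP Ck /eqP Dk.
have l_ge0 : 0 <= l`!%:R :> R by rewrite ler0n.
have trivial_le : \sum_s devq A s * devq B s * devq C s * devq D s <= l`!%:R.
  rewrite -card_Sn -sum1_card natr_sum; apply: ler_sum => s _.
  rewrite (le_trans (ler_norm _)) // !normrM.
  by rewrite !mulr_ile1 ?mulr_ge0 ?normr_dev_le1.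
have [isolated|] := boolP [|| ~~ [|| overlap A B, overlap A C | overlap A D],
    ~~ [|| overlap B A, overlap B C | overlap B D],
    ~~ [|| overlap C A, overlap C B | overlap C D]
  | ~~ [|| overlap D A, overlap D B | overlap D C]].
  rewrite (_ : \sum_s _ = 0).
    by rewrite mulr_ge0 // /clustered !addr_ge0 ?mulr_ge0 ?overlap_ind_ge0.
  case/or4P: isolated => /sum_dev_isolated;
    [move=> /(_ Ak)|move=> /(_ Bk)|move=> /(_ Ck)|move=> /(_ Dk)];
    by apply: etrans; apply: eq_bigr => s _; ring.
rewrite (overlapC B A) (overlapC C A) (overlapC C B).
rewrite (overlapC D A) (overlapC D B) (overlapC D C) => clust.
rewrite (le_trans trivial_le) // ler_peMr // /clustered /overlap_ind -!natrM -!natrD.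
rewrite ler1n; move: clust.
(* The statement about graphs on four vertices, checked on all 64 of them. *)
by do 6!case: (overlap _ _).
Qed.

Lemma fourth_moment :
  \sum_s (\sum_(A in ksets) devq A s) ^+ 4 <=
  l`!%:R * (7 * ('C(l, k)%:R * overlap_bound R l k) ^+ 2).
Proof.
apply: (@le_trans _ _ (l`!%:R * quad_sum k (@clustered R l))); last first.
  by rewrite ler_wpM2l ?ler0n // quad_sum_clustered.
have -> : \sum_s (\sum_(A in ksets) devq A s) ^+ 4 =
    quad_sum k (fun A B C D => \sum_s devq A s * devq B s * devq C s * devq D s).
  rewrite /quad_sum.
  under [RHS]eq_bigr => A _ do under eq_bigr => B _ do
    (under eq_bigr => C _ do rewrite exchange_big; rewrite exchange_big).
  under [RHS]eq_bigr => A _ do rewrite exchange_big.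
  rewrite exchange_big; apply: eq_bigr => s _ /=.
  rewrite !exprS expr0 mulr1 mulr_suml; apply: eq_bigr => A _.
  rewrite mulr_suml mulr_sumr; apply: eq_bigr => B _.
  rewrite mulrA mulr_suml mulr_sumr; apply: eq_bigr => C _.
  by rewrite mulrA mulr_sumr; apply: eq_bigr => D _.
rewrite /quad_sum mulr_sumr; apply: ler_sum => A kA.
rewrite mulr_sumr; apply: ler_sum => B kB.
rewrite mulr_sumr; apply: ler_sum => C kC.
rewrite mulr_sumr; apply: ler_sum => D kD.
exact: sum_dev4_le.
Qed.

End FourthMoment.

(** * Concentration of the density *)

Section Deviation.
Variable R : realType.

Lemma densityE k n (p : 'S_k) (t : 'S_n) :
  density R p t = (pattern_count p t)%:R / 'C(n, k)%:R.
Proof.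
rewrite /density /pattern_count; congr (_%:R / _); apply: eq_card => A.
apply/idP/idP; rewrite !inE /=; first by case/andP.
by move=> h; rewrite -(size_restriction t) (order_iso_size h) eqxx.
Qed.

(** If [n < k], the density is 0 by convention and there are no copies. *)
Lemma binM_density k n (p : 'S_k) (t : 'S_n) :
  'C(n, k)%:R * density R p t = (pattern_count p t)%:R.
Proof.
rewrite densityE; have [nk|kn] := ltnP n k; last first.
  by rewrite mulrC divfK // pnatr_eq0 -lt0n bin_gt0.
rewrite bin_small // mul0r /pattern_count eq_card0 // => A; rewrite !inE.
apply/negbTE/negP => /order_iso_size; rewrite size_restriction => Ak.
by have := max_card (mem A); rewrite Ak card_ord leqNgt nk.
Qed.

Lemma sum_dev l k (q : 'S_k) (s : 'S_l) : (k <= l)%N ->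
  \sum_(A in [set A : {set 'I_l} | #|A| == k]%SET) dev R q A s =
  'C(l, k)%:R * (density R q s - k`!%:R^-1).
Proof.
move=> kl; rewrite mulrBr binM_density /dev sumrB; congr (_ - _).
  rewrite /pattern_count -sum1_card natr_sum big_mkcond [RHS]big_mkcond /=.
  apply: eq_bigr => A _; rewrite !inE; case: eqP => [|Ak]; case: ifP => //.
  by move=> /order_iso_size; rewrite size_restriction.
by rewrite sumr_const card_draws card_ord mulr_natl.
Qed.

(** The identity k 'C(l, k) = l 'C(l - 1, k - 1): a k-set contains a given point
    with probability k/l. *)
Lemma overlap_boundE l k : (0 < k)%N -> (k <= l)%N ->
  l%:R * overlap_bound R l k = k%:R ^+ 2 * 'C(l, k)%:R.
Proof.
case: k l => // k [|l] // _ kl; rewrite /overlap_bound /= binS addKn natrM mulrCA.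
by rewrite -[l.+1%:R * _]natrM mul_bin_diag natrM expr2 mulrA.
Qed.

Lemma density_fourth_moment l k (q : 'S_k) : (0 < k)%N -> (k <= l)%N ->
  \sum_(s : 'S_l) (density R q s - k`!%:R^-1) ^+ 4 <=
  l`!%:R * (7 * k%:R ^+ 4 / l%:R ^+ 2).
Proof.
move=> k0 kl; have l0 : (l%:R : R) != 0.
  by rewrite pnatr_eq0 -lt0n (leq_trans k0).
have N0 : 0 < 'C(l, k)%:R :> R by rewrite ltr0n bin_gt0.
rewrite -(ler_pM2l (exprn_gt0 4 N0)) mulr_sumr.
have := fourth_moment R l q; under eq_bigr => s _ do rewrite sum_dev // exprMn.
move=> /le_trans; apply.
have -> : overlap_bound R l k = k%:R ^+ 2 * 'C(l, k)%:R / l%:R.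
  by rewrite -overlap_boundE // mulrC mulKf.
by rewrite le_eqVlt; apply/orP; left; apply/eqP; field.
Qed.

(** The Markov inequality for the fourth power. *)
Lemma density_tail l k (q : 'S_k) (e : R) : (0 < k)%N -> (k <= l)%N -> 0 < e ->
  #|[set s : 'S_l | e <= `|density R q s - k`!%:R^-1| ]%SET|%:R <=
  l`!%:R * (7 * k%:R ^+ 4 / e ^+ 4 / l%:R ^+ 2).
Proof.
move=> k0 kl e0; have e40 : 0 < e ^+ 4 by rewrite exprn_gt0.
rewrite -(ler_pM2l e40).
apply: (@le_trans _ _ (l`!%:R * (7 * k%:R ^+ 4 / l%:R ^+ 2))); last first.
  have l0 : (l%:R : R) != 0 by rewrite pnatr_eq0 -lt0n (leq_trans k0).
  by rewrite le_eqVlt; apply/orP; left; apply/eqP; field; rewrite l0 gt_eqF.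
apply: le_trans (density_fourth_moment q k0 kl).
rewrite -sum1_card natr_sum mulr_sumr big_mkcond /=; apply: ler_sum => s _.
have d4 (x : R) : x ^+ 4 = `|x| ^+ 4.
  by rewrite (exprM x 2 2) (exprM `|x| 2 2) real_normK ?num_real.
rewrite inE [leRHS]d4; case: ifP => [h|_]; last by rewrite exprn_ge0.
by rewrite mulr1 lerXn2r ?nnegrE // ?ltW.
Qed.

Lemma sum_inv_square_le k m : (0 < k)%N ->
  \sum_(i < m) ((i + k)%:R ^+ 2)^-1 <= 2 :> R.
Proof.
(* The bound 2 / (i + 1) - 2 / (i + 2) on the term of index i telescopes. *)
move=> k0; suff : \sum_(i < m) ((i + k)%:R ^+ 2)^-1 <= 2 - 2 / m.+1%:R :> R.
  by move=> /le_trans; apply; rewrite lerBlDr lerDl divr_ge0 ?ler0n.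
elim: m => [|m ih]; first by rewrite big_ord0 divr1 subrr.
rewrite big_ord_recr /= (le_trans (lerD ih (lexx _))) //.
have m1 : 0 < m.+1%:R :> R by rewrite ltr0n.
have m2 : m.+2%:R = m.+1%:R + 1 :> R by rewrite -natr1.
apply: (@le_trans _ _ (2 - 2 / m.+1%:R + (m.+1%:R ^+ 2)^-1)).
  rewrite lerD2l lef_pV2 ?posrE ?exprn_gt0 ?ltr0n ?addn_gt0 ?k0 ?orbT //.
  by rewrite lerXn2r ?nnegrE ?ler0n // ler_nat -addn1 leq_add2l.
rewrite m2; set x : R := m.+1%:R in m1 *.
have x1 : 1 <= x by rewrite ler1n.
rewrite -subr_ge0.
have -> : 2 - 2 / (x + 1) - (2 - 2 / x + (x ^+ 2)^-1) = (x - 1) / (x ^+ 2 * (x + 1)).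
  by field; apply/andP; split; rewrite gt_eqF //; lra.
by rewrite divr_ge0 ?subr_ge0 // mulr_ge0 ?exprn_ge0 ?addr_ge0 // ltW.
Qed.

End Deviation.

Section AlmostSure.
Variables (R : realType) (d : measure_display) (T : measurableType d).
Variable P : probability T R.

Lemma uniform_perm_preimage l (X : T -> 'S_l) (S : {set 'S_l}) :
  uniform_perm P X ->
  measurable (X @^-1` [set` S]) /\
  P (X @^-1` [set` S]) = (#|S|%:R / l`!%:R)%:E.
Proof.
move=> uX; have -> : X @^-1` [set` S] = \bigcup_(s in [set` S]) X @^-1` [set s].
  by apply/seteqP; split=> [w Sw|w [s /= Ss ->]//]; exists (X w).
have mX s : [set` S] s -> measurable (X @^-1` [set s]) by move=> _; case: (uX s).
split; first by apply: fin_bigcup_measurable => //; exact: finite_finset.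
have tX : trivIset [set` S] (fun s => X @^-1` [set s]).
  by move=> s s' _ _ [w [/= -> ->]].
rewrite (measure_fin_bigcup P (finite_finset (X := [set` S])) tX mX).
have -> : [set` S] = [set` enum S].
  by apply/seteqP; split=> s /=; rewrite mem_enum.
rewrite -fsbig_seq ?enum_uniq //.
rewrite (eq_bigr (fun=> (l`!%:R^-1)%:E)); last by move=> s _; case: (uX s).
by rewrite sumEFin big_enum /= sumr_const mulr_natl.
Qed.

(** The Borel-Cantelli lemma for each tolerance 1/(m + 1), then an intersection
    over m. *)
Lemma ae_density_cvg k (q : 'S_k) (X : forall l, T -> 'S_l) : (0 < k)%N ->
  (forall l, (0 < l)%N -> uniform_perm P (X l)) ->
  {ae P, forall w, density R q (X l w) @[l --> \oo] --> (k`!%:R^-1 : R)}.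
Proof.
move=> k0 uX.
pose S m l := [set s : 'S_l | m.+1%:R^-1 <= `|density R q s - k`!%:R^-1| ]%SET.
(* Shifting the index by k makes the moment bound available for every l. *)
pose E m l := X (l + k)%N @^-1` [set` S m (l + k)%N].
have lk0 l : (0 < l + k)%N by rewrite addn_gt0 k0 orbT.
have mE m l : measurable (E m l).
  by have [] := uniform_perm_preimage (S m (l + k)%N) (uX _ (lk0 l)).
have PE m l : (P (E m l) <=
    ((7 * k%:R ^+ 4 * m.+1%:R ^+ 4) * ((l + k)%:R ^+ 2)^-1)%:E)%E.
  have [_ ->] := uniform_perm_preimage (S m (l + k)%N) (uX _ (lk0 l)).
  have m0 : 0 < m.+1%:R^-1 :> R by rewrite invr_gt0.
  have f0 : 0 < (l + k)`!%:R :> R by rewrite ltr0n fact_gt0.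
  rewrite lee_fin ler_pdivrMr // mulrC.
  apply: le_trans (density_tail q k0 (leq_addl l k) m0) _.
  by rewrite exprVn invrK.
have EN m : P.-negligible (lim_sup_set (E m)).
  have mL : measurable (lim_sup_set (E m)).
    apply: bigcapT_measurable => i; apply: bigcup_measurable => j _; exact: mE.
  apply/(negligibleP _ mL); apply: lim_sup_set_cvg0 => //.
  set C : R := 7 * k%:R ^+ 4 * m.+1%:R ^+ 4.
  have C0 : 0 <= C by rewrite !mulr_ge0 ?exprn_ge0 ?ler0n.
  apply: (@le_lt_trans _ _ (C * 2)%:E); last exact: ltry.
  apply: lime_le; first by apply: is_cvg_nneseries => *; exact: measure_ge0.
  apply: nearW => j; rewrite big_mkord.
  apply: (@le_trans _ _ (\sum_(i < j) (C * ((i + k)%:R ^+ 2)^-1)%:E)%E).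
    by apply: lee_sum => i _; exact: PE.
  by rewrite sumEFin lee_fin -mulr_sumr ler_wpM2l // sum_inv_square_le.
have : {ae P, forall w, forall m, ~ lim_sup_set (E m) w}.
  apply: ae_foralln => m; apply: negligibleS (EN m) => w /=.
  by move/contrapT.
apply: filterS => w hw.
rewrite -(cvg_shiftn k); apply/cvgrPdist_le => e e0.
have [m me] : exists m : nat, m.+1%:R^-1 < e.
  have := @near_infty_natSinv_lt R (PosNum e0); case=> N _ /(_ N (leqnn N)).
  by exists N.
have /existsNP[N /not_implyP[_ hN]] := hw m.
exists N => // j /= Nj; rewrite distrC leNgt; apply/negP => h.
by apply: hN; exists j => //; rewrite /E /= inE (le_trans (ltW me)) // ltW.
Qed.

End AlmostSure.

(** * Passing to the limit *)

Section Asymptotics.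
Variable R : realType.

Lemma cvg_bin_expn m :
  'C(l, m)%:R / l%:R ^+ m @[l --> \oo] --> (m`!%:R^-1 : R).
Proof.
have cvgV : l%:R^-1 @[l --> \oo] --> (0 : R).
  rewrite -(cvg_shiftn 1); under eq_fun do rewrite addn1.
  exact: cvg_harmonic.
have : (l ^_ m)%:R / l%:R ^+ m @[l --> \oo] --> (1 : R).
  elim: m => [|m ih].
    by under eq_fun do rewrite expr0 divr1; exact: cvg_cst.
  have : (1 - m%:R * l%:R^-1) @[l --> \oo] --> (1 : R).
    rewrite -[X in _ --> X]subr0 -[X in 1 - X](mulr0 m%:R).
    by apply: cvgB; [exact: cvg_cst | apply: cvgMr].
  move=> /(cvgM ih); rewrite mulr1; apply: cvg_trans; apply: near_eq_cvg.
  exists m.+1 => // l /= ml.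
  have l0 : (l%:R : R) != 0 by rewrite pnatr_eq0 -lt0n (leq_trans _ ml).
  rewrite ffactnSr natrM natrB ?(ltnW ml) // exprSr.
  by field; rewrite l0 expf_neq0.
have m0 : (m`!%:R : R) != 0 by rewrite pnatr_eq0 -lt0n fact_gt0.
move=> /cvgM /(_ (@cvg_cst _ (m`!%:R^-1 : R) _ _ _)); rewrite mul1r.
apply: cvg_trans; apply: near_eq_cvg; apply: nearW => l /=.
by rewrite -bin_ffact natrM mulrAC mulfK.
Qed.

(** The exact count, normalized so that each factor has a limit: the power l^k is
    distributed over the blocks, whose lengths add up to k. *)
Lemma density_tensor n l k (t : 'S_n) (g : 'S_l) (p : 'S_k) :
  (0 < n)%N -> (0 < k)%N -> (0 < l)%N ->
  density R p (tensor t g) =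
  ('C(n * l, k)%:R / (n * l)%:R ^+ k)^-1 / n%:R ^+ k *
  \sum_(x <- fset_set (block_decompositions p))
    ('C(n, plen x.1)%:R * density R (tagged x.1) t *
     \prod_(c <- x.2) ('C(l, plen c)%:R / l%:R ^+ plen c *
                       density R (tagged c) g)).
Proof.
move=> n_gt0 k_gt0 l_gt0; rewrite densityE pattern_count_tensor // natr_sum.
have n0 : (n%:R : R) != 0 by rewrite pnatr_eq0 -lt0n.
have l0 : (l%:R : R) != 0 by rewrite pnatr_eq0 -lt0n.
have -> : ('C(n * l, k)%:R / (n * l)%:R ^+ k)^-1 / n%:R ^+ k =
    'C(n * l, k)%:R^-1 * l%:R ^+ k :> R.
  by rewrite invf_div natrM exprMn mulrAC [X in X / _]mulrAC divff ?expf_neq0 //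
    mul1r mulrC.
rewrite [LHS]mulrC -mulrA; congr (_ * _).
rewrite mulr_sumr; apply: eq_big_seq => x.
rewrite in_fset_set ?inE; last exact: finite_block_decompositions.
move=> [_ bk _ _]; rewrite -bk natrM binM_density natr_prod mulrCA; congr (_ * _).
elim: (x.2) => [|c b ih]; first by rewrite !big_nil mulr1.
rewrite !big_cons /= exprD ih -binM_density.
by field; rewrite expf_neq0.
Qed.

End Asymptotics.

(** There are countably many patterns. *)
Lemma ae_all_densities (R : realType) (d : measure_display) (T : measurableType d)
    (P : probability T R) (X : forall l, T -> 'S_l) :
  (forall l, (0 < l)%N -> uniform_perm P (X l)) ->
  {ae P, forall w, forall c : permutation,
    density R (tagged c) (X l w) @[l --> \oo] --> ((plen c)`!%:R^-1 : R)}.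
Proof.
move=> uX; pose Q n w := if @unpickle permutation n is Some c
  then density R (tagged c) (X l w) @[l --> \oo] --> ((plen c)`!%:R^-1 : R)
  else True.
have : {ae P, forall w, forall n, Q n w}.
  apply: ae_foralln => n; rewrite /Q; case: unpickle => [c|]; last exact: nearW.
  exact: ae_density_cvg.
by apply: filterS => w hw c; have := hw (pickle c); rewrite /Q pickleK.
Qed.

Theorem theorem10 (R : realType) (d : measure_display) (T : measurableType d)
    (P : probability T R)
    (n : nat) (n_gt0 : (0 < n)%N) (tau : 'S_n)
    (lambda : forall l : nat, T -> 'S_l)
    (lambda_uniform : forall l : nat, (0 < l)%N -> uniform_perm P (lambda l))
    (k : nat) (k_gt0 : (0 < k)%N) (p : 'S_k) :
  {ae P, forall omega : T,
    density R p (tensor tau (lambda l omega)) @[l --> \oo] -->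
    k`!%:R / n%:R ^+ k *
    \sum_(x \in block_decompositions p)
      ('C(n, plen x.1)%:R * density R (tagged x.1) tau *
       \prod_(c <- x.2) ((plen c)`!%:R ^+ 2)^-1)}.
Proof.
apply: filterS (ae_all_densities lambda_uniform) => w hw.
rewrite fsbig_finite; last exact: finite_block_decompositions.
have nl_oo : (n * l)%N @[l --> \oo] --> \oo.
  move=> A [N _ NA]; exists N => // l /= Nl; apply: NA => /=.
  by rewrite (leq_trans Nl) // leq_pmull.
have := cvg_comp _ _ nl_oo (@cvg_bin_expn R k).
have kf0 : (k`!%:R^-1 : R) != 0 by rewrite invr_eq0 pnatr_eq0 -lt0n fact_gt0.
move=> /(cvgV kf0); rewrite invrK => bin_cvg.
have ratio : ('C(n * l, k)%:R / (n * l)%:R ^+ k)^-1 / n%:R ^+ k @[l --> \oo]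
    --> (k`!%:R / n%:R ^+ k : R) by apply: cvgM bin_cvg (cvg_cst _).
pose u x l : R := 'C(n, plen x.1)%:R * density R (tagged x.1) tau *
  \prod_(c <- x.2) ('C(l, plen c)%:R / l%:R ^+ plen c *
                    density R (tagged c) (lambda l w)).
have u_cvg x : u x l @[l --> \oo] --> 'C(n, plen x.1)%:R * density R (tagged x.1) tau *
    \prod_(c <- x.2) ((plen c)`!%:R ^+ 2)^-1.
  apply: cvgM; first exact: cvg_cst.
  apply: (cvg_big (@mul_continuous R)) => c _; rewrite expr2 invfM.
  exact: cvgM (@cvg_bin_expn R (plen c)) (hw c).
have sum_cvg : \sum_(x <- fset_set (block_decompositions p)) u x l @[l --> \oo] -->
    \sum_(x <- fset_set (block_decompositions p))
      ('C(n, plen x.1)%:R * density R (tagged x.1) tau *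
       \prod_(c <- x.2) ((plen c)`!%:R ^+ 2)^-1).
  by apply: (cvg_big (@add_continuous R)) => x _; exact: u_cvg.
apply: cvg_trans (cvgM ratio sum_cvg).
apply: near_eq_cvg; exists 1%N => // l /= l_gt0.
by rewrite density_tensor.
Qed.
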